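(* Assume (a)–(g) of the context. Let $0<\Delta_0<\Delta$ and $X_0\in\mathcal{M}$ with $\delta(X_0)\le\Delta_0$. Let $\lambda=2M_fC_n/a_1$, with $M_f$ from (f) and $C_n,a_1$ the constants fixed in the context, and let $\mathcal{L}_\lambda(X):=f(X)+\lambda\,\delta(X)$. There exist $\bar\alpha'',\bar\beta'',\tau'',c_\delta,c_t>0$ such that for constant step sizes $\alpha,\beta>0$ with $\alpha\le\bar\alpha''$, $\beta\le\bar\beta''$, $\beta\le\tau''\alpha$, the iterates $$X_{k+1}=\mathrm{R}^{\mathcal{M}}_{X_k}\big(\alpha\,G_h(X_k)+\beta\,G_f(X_k)\big),\qquad k=0,1,2,\dots$$ satisfy, for all $k\ge0$, $X_k\in\mathcal{K}\cap\mathcal{M}$ and $$\mathcal{L}_\lambda(X_{k+1})\le\mathcal{L}_\lambda(X_k)-c_\delta\,\alpha\,\delta(X_k)-c_t\,\beta\,\|G_f(X_k)\|^2.$$ Moreover, for all $K\ge1$, $$\min_{0\le k\le K-1}\delta(X_k)\le\frac{\mathcal{L}_\lambda(X_0)-f_{\inf}}{c_\delta\,\alpha K},\qquad\min_{0\le k\le K-1}\|G_f(X_k)\|^2\le\frac{\mathcal{L}_\lambda(X_0)-f_{\inf}}{c_t\,\beta K},$$ and $\delta(X_k)\to0$, $\|G_f(X_k)\|\to0$ as $k\to\infty$.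
   Context: Setting. $\mathcal{E}$ is a finite-dimensional Euclidean space, $\mathcal{M}\subseteq\mathcal{E}$ a smooth embedded submanifold, $f:\mathcal{E}\to\mathbb{R}$ and $h:\mathcal{E}\to\mathbb{R}^q$ smooth, $\mathcal{H}:=\{X\in\mathcal{E}\mid h(X)=0\}$, $\delta(X):=\mathrm{dist}(X,\mathcal{H})$. $\mathcal{P}_{\mathcal{C}}$ is nearest-point projection onto $\mathcal{C}$; $\mathrm{T},\mathrm{N}$ denote tangent and normal spaces; $\mathrm{D}h_X^*$ is the adjoint of $\mathrm{D}h_X$; $\mathrm{grad}_{\mathcal{M}}f(X)=\mathcal{P}_{\mathrm{T}_{\mathcal{M}}(X)}(\nabla f(X))$. $\mathrm{R}^{\mathcal{M}}$ is a retraction on $\mathcal{M}$: a smooth map from the tangent bundle of $\mathcal{M}$ to $\mathcal{M}$, with restriction $\mathrm{R}^{\mathcal{M}}_X$ to $\mathrm{T}_{\mathcal{M}}(X)$, such that for $\xi\in\mathrm{T}_{\mathcal{M}}(X)$ the curve $\gamma(t)=\mathrm{R}^{\mathcal{M}}_X(t\xi)$ satisfies $\gamma(0)=X$, $\gamma'(0)=\xi$. For $\Delta>0$ let $\mathcal{K}:=\{X\in\mathcal{E}\mid\delta(X)<\Delta\}$. For $X\in\mathcal{K}$: $\mathcal{H}_X:=\{\tilde X\in\mathcal{E}\mid h(\tilde X)=h(X)\}$ and $d(X):=-\mathrm{D}h_X^*(\mathrm{D}h_X\mathrm{D}h_X^* )^{-1}h(X)$. For $X\in\mathcal{K}\cap\mathcal{M}$: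 $S(X):=\mathrm{T}_{\mathcal{H}_X\cap\mathcal{M}}(X)=\mathrm{T}_{\mathcal{H}_X}(X)\cap\mathrm{T}_{\mathcal{M}}(X)=\ker\mathrm{D}h_X\cap\mathrm{T}_{\mathcal{M}}(X)$ (equality under (b)), $G_h(X):=\mathcal{P}_{\mathrm{T}_{\mathcal{M}}(X)}(d(X))$, $G_f(X):=\mathcal{P}_{S(X)}(-\nabla f(X))$. Assumptions. (a) $\mathrm{D}h_X$ has full rank $q$ for all $X\in\mathcal{K}$. (b) For all $X\in\mathcal{K}\cap\mathcal{M}$, $\mathcal{H}_X$ and $\mathcal{M}$ are intrinsically transversal at $X$. (Submanifolds $\mathcal{X},\mathcal{Y}$ are intrinsically transversal at $Z\in\mathcal{X}\cap\mathcal{Y}$ if there are $\kappa\in(0,1]$ and a neighborhood of $Z$ such that for all $X'\in\mathcal{X}\setminus\mathcal{Y}$, $Y'\in\mathcal{Y}\setminus\mathcal{X}$ in it, with $u=(X'-Y')/\|X'-Y'\|$, $\max\{\mathrm{dist}(u,\mathrm{N}_{\mathcal{Y}}(Y')),\mathrm{dist}(u,-\mathrm{N}_{\mathcal{X}}(X'))\}\ge\kappa$.) (c) $\mathcal{P}_{\mathcal{H}}$ is single-valued and Lipschitz on $\mathcal{K}$, and $f_{\inf}:=\inf\{f(X)\mid X\in\mathcal{K}\cap\mathcal{M}\}>-\infty$. (d) There are $\sigma,\mu,L_h>0$ with $\sigma^2I_q\preceq\mathrm{D}h_X\mathrm{D}h_X^*\preceq\mu^2I_q$ and $\|\mathrm{D}h_X-\mathrm{D}h_Y\|\le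 L_h\|X-Y\|$ for all $X,Y\in\mathcal{K}$. (e) $\mathcal{P}_{\mathcal{H}}$ is $C^1$ on $\mathcal{K}$ and there is $L_p>0$ with $\|\mathrm{D}(\mathcal{P}_{\mathcal{H}})_X-\mathrm{D}(\mathcal{P}_{\mathcal{H}})_Y\|\le L_p\|X-Y\|$ for all $X,Y\in\mathcal{K}$. (f) There are $L_R,L_f,M_f,\rho_{\mathcal{M}}>0$ such that for all $X\in\mathcal{K}\cap\mathcal{M}$ and $\eta\in\mathrm{T}_{\mathcal{M}}(X)$ with $\|\eta\|\le\rho_{\mathcal{M}}$: $\|X+\eta-\mathrm{R}^{\mathcal{M}}_X(\eta)\|\le L_R\|\eta\|^2$, $\|\mathrm{grad}_{\mathcal{M}}f(X)\|\le M_f$, and $f(\mathrm{R}^{\mathcal{M}}_X(\eta))\le f(X)+\langle\mathrm{grad}_{\mathcal{M}}f(X),\eta\rangle+\frac{L_f}{2}\|\eta\|^2$. (g) There is $\kappa_0>0$ with $\|\mathcal{P}_{\mathrm{T}_{\mathcal{M}}(X)}(d(X))\|\ge\kappa_0\|d(X)\|$ for all $X\in\mathcal{K}\cap\mathcal{M}$. Constants $C_n$ and $a_1$. These are constants supplied by earlier estimates under (a)–(g): $C_n>0$ is such that $\|G_h(X)\|\le C_n\,\delta(X)$ for all $X\in\mathcal{K}\cap\mathcal{M}$, and $a_1>0$ is, together with some $a_2,a_3,a_4,\bar\alpha,\bar\beta>0$, such that for all $X\in\mathcal{K}\cap\mathcal{M}$, $0<\alpha\le\bar\alpha$, $0<\beta\le\bar\beta$,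 the point $X_+=\mathrm{R}_X^{\mathcal{M}}(\alpha G_h(X)+\beta G_f(X))$ satisfies $\delta(X_+)\le(1-a_1\alpha+a_2\alpha^2)\delta(X)+a_3\beta\,\delta(X)\|G_f(X)\|+a_4\beta^2\|G_f(X)\|^2$. *)

(* Defs.v *)
From HB Require Import structures.
From mathcomp Require Import all_boot all_order all_algebra.
From mathcomp Require Import all_classical all_reals all_analysis.
From mathcomp Require Import ring lra.

Set Implicit Arguments.
Unset Strict Implicit.
Unset Printing Implicit Defensive.

Import Order.TTheory GRing.Theory Num.Theory.
Import numFieldNormedType.Exports.

Local Open Scope classical_set_scope.
Local Open Scope ring_scope.

(* A finite-dimensional real vector space whose norm [`|u|] (hence whose
   topology and differential calculus) comes from the inner product [dotp]. *)
HB.mixin Record isEuclidean (R : realType) E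
    of NormedModule R E & Vector R E := {
  dotp : E -> E -> R ;
  dotpC : forall u v, dotp u v = dotp v u ;
  dotpDl : forall u v w, dotp (u + v) w = dotp u w + dotp v w ;
  dotpZl : forall (a : R) u v, dotp (a *: u) v = a * dotp u v ;
  dotpp : forall u, dotp u u = `|u| ^+ 2
}.

#[short(type="euclideanType")]
HB.structure Definition Euclidean (R : realType) :=
  {E of NormedModule R E & Vector R E & isEuclidean R E}.

Notation "''[' u , v ]" := (dotp u v)
  (at level 0, format "''[' u ,  v ]")
  : ring_scope.

(* R^n with the standard inner product. The alias is needed because the
   library norms ['rV[R]_n] with the sup norm. *)
Definition euclid (R : realType) (n : nat) : Type := 'rV[R]_n.

HB.instance Definition _ (R : realType) n := Vector.on (euclid R n).

Section EuclidInstance.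
Variables (R : realType) (n : nat).
Implicit Types u v w : euclid R n.

Definition euclid_dot u v : R :=
  \sum_(i < n) (u : 'rV[R]_n) ord0 i * (v : 'rV[R]_n) ord0 i.
Definition euclid_norm u : R := Num.sqrt (euclid_dot u u).

Fact euclid_dotC u v : euclid_dot u v = euclid_dot v u.
Proof. by apply: eq_bigr => i _; rewrite mulrC. Qed.

Fact euclid_dotDl u v w :
  euclid_dot (u + v) w = euclid_dot u w + euclid_dot v w.
Proof. by rewrite -big_split; apply: eq_bigr => i _; rewrite mxE mulrDl. Qed.

Fact euclid_dotZl (a : R) u v : euclid_dot (a *: u) v = a * euclid_dot u v.
Proof. by rewrite /euclid_dot mulr_sumr; apply: eq_bigr => i _; rewrite mxE mulrA. Qed.

Fact euclid_dot_ge0 u : 0 <= euclid_dot u u.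
Proof. by apply: sumr_ge0 => i _; rewrite -expr2 sqr_ge0. Qed.

Fact euclid_dotpp u : euclid_dot u u = euclid_norm u ^+ 2.
Proof. by rewrite sqr_sqrtr// euclid_dot_ge0. Qed.

Fact euclid_norm0_eq0 u : euclid_norm u = 0 -> u = 0.
Proof.
move=> u0; have /eqP : euclid_dot u u = 0 by rewrite euclid_dotpp u0 expr0n.
rewrite psumr_eq0 => [/allP u0'|i _]; last by rewrite -expr2 sqr_ge0.
apply/rowP => i; rewrite mxE; apply/eqP; rewrite -sqrf_eq0 expr2.
by apply: u0'; rewrite mem_index_enum.
Qed.

Fact euclid_normZ (a : R) u : euclid_norm (a *: u) = `|a| * euclid_norm u.
Proof.
rewrite /euclid_norm euclid_dotZl euclid_dotC euclid_dotZl mulrA -expr2.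
by rewrite sqrtrM ?sqr_ge0// sqrtr_sqr.
Qed.

Fact euclid_cauchy u v : euclid_dot u v <= euclid_norm u * euclid_norm v.
Proof.
set a := euclid_norm u; set b := euclid_norm v.
have a0 : 0 <= a by exact: sqrtr_ge0.
have b0 : 0 <= b by exact: sqrtr_ge0.
have [/euclid_norm0_eq0 ->|an] := eqVneq a 0.
  rewrite -(scale0r (0 : euclid R n)) euclid_dotZl mul0r; exact: mulr_ge0.
have [v0|bn] := eqVneq b 0.
  rewrite (euclid_norm0_eq0 v0) -(scale0r (0 : euclid R n)) euclid_dotC.
  by rewrite euclid_dotZl mul0r mulr_ge0.
have ab0 : 0 < a * b by rewrite mulr_gt0// lt_neqAle eq_sym ?an ?bn.
have := euclid_dot_ge0 (b *: u + (- a) *: v).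
rewrite euclid_dotDl !euclid_dotZl (euclid_dotC u) (euclid_dotC v).
rewrite !euclid_dotDl !euclid_dotZl (euclid_dotC v u) !euclid_dotpp -/a -/b => H.
have : 0 <= (a * b) * (a * b - euclid_dot u v) by nra.
by rewrite pmulr_rge0// subr_ge0.
Qed.

Fact euclid_normD u v : euclid_norm (u + v) <= euclid_norm u + euclid_norm v.
Proof.
rewrite -(@ler_pXn2r _ 2%N) ?nnegrE ?addr_ge0 ?sqrtr_ge0//.
rewrite -euclid_dotpp euclid_dotDl (euclid_dotC u) (euclid_dotC v) !euclid_dotDl.
rewrite !euclid_dotpp (euclid_dotC v u) sqrrD.
by have := euclid_cauchy u v; lra.
Qed.

HB.instance Definition _ := @Lmodule_isNormed.Build R (euclid R n)
  euclid_norm euclid_normD euclid_normZ euclid_norm0_eq0.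

HB.instance Definition _ := @isEuclidean.Build R (euclid R n)
  euclid_dot euclid_dotC euclid_dotDl euclid_dotZl euclid_dotpp.

End EuclidInstance.

Section Calculus.
Variable R : realType.

(* C^k on an open set of a finite-dimensional space: all iterated directional
   derivatives up to order k exist and are continuous. *)
Fixpoint Ck_on (V W : normedModType R) (k : nat) (U : set V) (g : V -> W)
    : Prop :=
  if k is k'.+1 then
    (forall x, U x -> differentiable g x) /\
    (forall v, Ck_on k' U (fun x => 'd g x v))
  else forall x, U x -> {for x, continuous g}.

Definition smooth_on (V W : normedModType R) (U : set V) (g : V -> W) : Prop :=
  forall k, Ck_on k U g.

Variables E F : euclideanType R.

(* The derivative as an element of ['Hom(E, F)], so as to use its rank,
   composition and inverse from the library. *)
Definition Dlin (g : E -> F) (X : E) : 'Hom(E, F) := linfun ('d g X).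

(* The vectors and maps selected by [xget] in [gradient] and [adjoint] are
   unique; they exist by Riesz representation ([g] differentiable at [X] for
   the gradient). *)
Definition gradient (g : E -> R) (X : E) : E :=
  xget 0 [set u : E | forall v, 'd g X v = '[u, v]].

Definition adjoint (L : 'Hom(E, F)) : 'Hom(F, E) :=
  xget 0 [set A : 'Hom(F, E) | forall u w, '[L u, w] = '[u, A w]].

Definition opnorm (L : 'Hom(E, F)) : R :=
  sup [set `|L v| | v in [set v : E | `|v| <= 1]].

Definition loewner_le (A B : 'End(F)) : Prop :=
  forall w, 0 <= '[(B - A) w, w].

(* Beware that [inf set0 = 0], so [dist X set0 = 0] instead of [+oo]. *)
Definition dist (X : E) (A : set E) : R := inf [set `|X - Y| | Y in A].

Definition nearest (A : set E) (X : E) : set E :=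
  [set P | A P /\ forall Y, A Y -> `|X - P| <= `|X - Y|].

Definition metric_proj (A : set E) (X : E) : E := xget 0 (nearest A X).

End Calculus.

Section Submanifolds.
Variables (R : realType) (E : euclideanType R).

Definition local_defining (M : set E) (X : E) (k : nat) (U : set E)
    (phi : E -> euclid R k) : Prop :=
  [/\ open U, U X, smooth_on U phi, \dim (limg (Dlin phi X)) = k
    & forall Y, U Y -> (M Y <-> phi Y = 0)].

Definition embedded_submanifold (M : set E) : Prop :=
  exists k : nat, forall X, M X ->
    exists (U : set E) (phi : E -> euclid R k), local_defining M X U phi.

(* The tangent space is the kernel of the differential at [X] of a local
   defining function of [M]. All of these kernels coincide, so intersecting
   them avoids choosing one. This is only meaningful at a point [X] of [M]
   near which [M] is an embedded submanifold. *)
Definition tangent_space (M : set E) (X : E) : set E :=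
  [set v | forall k (U : set E) (phi : E -> euclid R k),
     local_defining M X U phi -> Dlin phi X v = 0].

Definition normal_space (M : set E) (X : E) : set E :=
  [set w | forall v, tangent_space M X v -> '[w, v] = 0].

Definition intrinsically_transversal (A B : set E) (Z : E) : Prop :=
  exists kappa : R, [/\ 0 < kappa, kappa <= 1 &
    exists2 U : set E, nbhs Z U &
      forall X' Y', (A `\` B) X' -> (B `\` A) Y' -> U X' -> U Y' ->
        let u := `|X' - Y'|^-1 *: (X' - Y') in
        kappa <= Num.max (dist u (normal_space B Y'))
                         (dist u [set - w | w in normal_space A X'])].

Definition tangent_bundle (M : set E) : set (E * E) :=
  [set p | M p.1 /\ tangent_space M p.1 p.2].

(* Only the values of [Rt] on the tangent bundle matter. Smoothness of a map
   on this submanifold of [E * E] means that it locally extends to a smooth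
   map on an open subset of [E * E]. *)
Definition is_retraction (M : set E) (Rt : E -> E -> E) : Prop :=
  [/\ forall p, tangent_bundle M p -> M (Rt p.1 p.2),
      forall p, tangent_bundle M p ->
        exists (U : set (E * E)) (Phi : E * E -> E),
          [/\ open U, U p, smooth_on U Phi &
              forall p', U p' -> tangent_bundle M p' ->
                Rt p'.1 p'.2 = Phi p']
    & forall X xi, M X -> tangent_space M X xi ->
        let gamma := fun t : R => Rt X (t *: xi) in
        gamma 0 = X /\ is_derive (0 : R) 1 gamma xi].

End Submanifolds.

Section Problem.
Variables (R : realType) (E : euclideanType R) (q : nat).
Variables (f : E -> R) (h : E -> euclid R q) (M : set E).

Definition feasible : set E := [set X | h X = 0].

Definition delta (X : E) : R := dist X feasible.

Definition tube (Delta : R) : set E := [set X | delta X < Delta].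

Definition level (X : E) : set E := [set Y | h Y = h X].

(* Dh_X Dh_X^* *)
Definition gram (X : E) : 'End(euclid R q) :=
  (Dlin h X \o adjoint (Dlin h X))%VF.

Definition dnormal (X : E) : E :=
  - adjoint (Dlin h X) ((gram X)^-1%VF (h X)).

Definition rgrad (X : E) : E := metric_proj (tangent_space M X) (gradient f X).

(* ker Dh_X `&` T_M(X), which is T_(H_X `&` M)(X) under transversality. *)
Definition Sspace (X : E) : set E :=
  [set v | Dlin h X v = 0] `&` tangent_space M X.

Definition Gh (X : E) : E := metric_proj (tangent_space M X) (dnormal X).

Definition Gf (X : E) : E := metric_proj (Sspace X) (- gradient f X).

End Problem.

(* Main.v *)
(** The merit function f + lambda delta decreases at every step. Since S(X) lies
    in T_M(X), the component of -grad f orthogonal to G_f does not see G_f, so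
    <grad f, G_f> = -|G_f|^2 and |G_f| <= Mf; thus along
    eta = alpha G_h + beta G_f the function f decreases by about beta |G_f|^2
    and increases by at most alpha Mf Cn delta to first order. The bound on
    delta(X_+) makes lambda delta decrease by lambda a1 alpha delta =
    2 alpha Mf Cn delta to first order, twice as much. Each remaining term is a
    small multiple of alpha delta or of beta |G_f|^2: |eta|^2 is at most
    2 alpha^2 Cn^2 delta^2 + 2 beta^2 |G_f|^2, and the cross term
    beta delta |G_f| is at most tau Mf alpha delta when beta <= tau alpha. The
    same smallness makes the sublevel set delta <= Delta0 invariant, so the
    iterates stay where the estimates hold; the rates and limits follow by
    telescoping. *)
Require Import Defs.
From HB Require Import structures.
From mathcomp Require Import all_boot all_order all_algebra.
From mathcomp Require Import all_classical all_reals all_analysis.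
From mathcomp Require Import ring lra.

Set Implicit Arguments.
Unset Strict Implicit.
Unset Printing Implicit Defensive.

Import Order.TTheory GRing.Theory Num.Theory.
Import numFieldNormedType.Exports.

Local Open Scope classical_set_scope.
Local Open Scope ring_scope.

(** * Inner products and orthogonal projection onto subspaces *)

Section InnerProduct.
Variables (R : realType) (E : euclideanType R).
Implicit Types (u v w X P : E) (T : set E).

Lemma dotpDr u v w : '[u, v + w] = '[u, v] + '[u, w].
Proof. by rewrite dotpC dotpDl !(dotpC u). Qed.

Lemma dotpZr (a : R) u v : '[u, a *: v] = a * '[u, v].
Proof. by rewrite dotpC dotpZl dotpC. Qed.

Lemma dotpNl u v : '[- u, v] = - '[u, v].
Proof. by rewrite -scaleN1r dotpZl mulN1r. Qed.

Lemma dotpBl u v w : '[u - v, w] = '[u, w] - '[v, w].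
Proof. by rewrite dotpDl dotpNl. Qed.

Lemma dotp0r u : '[u, 0] = 0 :> R.
Proof. by rewrite -(scale0r (0 : E)) dotpZr mul0r. Qed.

Lemma sqr_normD u v : `|u + v| ^+ 2 = `|u| ^+ 2 + 2 * '[u, v] + `|v| ^+ 2.
Proof. by rewrite -!dotpp dotpDl !dotpDr (dotpC v u); ring. Qed.

Lemma cauchy_schwarz u v : '[u, v] <= `|u| * `|v|.
Proof.
have : `|u + v| ^+ 2 <= (`|u| + `|v|) ^+ 2.
  by rewrite ler_pXn2r ?nnegrE ?addr_ge0// ler_normD.
by rewrite sqr_normD; lra.
Qed.

Lemma sqr_normD_le u v : `|u + v| ^+ 2 <= 2 * `|u| ^+ 2 + 2 * `|v| ^+ 2.
Proof.
have := sqr_ge0 (`|u| - `|v|); have := cauchy_schwarz u v.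
by rewrite sqr_normD; lra.
Qed.

(** A predicate on sets, because [tangent_space] and [Sspace] are sets rather than elements of
    [{vspace E}]. *)
Definition subspace T : Prop :=
  [/\ T 0, forall u v, T u -> T v -> T (u + v) & forall (a : R) u, T u -> T (a *: u)].

(** Take [U] of maximal dimension inside [T]: adding the line through a vector of [T] stays inside
    [T], so by maximality it adds nothing. *)
Lemma subspace_vspace T : subspace T -> exists U : {vspace E}, forall v : E, T v <-> v \in U.
Proof.
move=> [T0 TD TZ].
pose P (n : nat) := `[< exists U : {vspace E}, \dim U = n /\ (forall v : E, v \in U -> T v) >].
have Pex : exists n, P n.
  exists 0%N; apply/asboolP; exists 0%VS; split; first exact: dimv0.
  by move=> v; rewrite memv0 => /eqP ->.
have Pub n : P n -> (n <= \dim {:E})%N.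
  by move=> /asboolP [U [<- _]]; apply: dimvS; exact: subvf.
case: (ex_maxnP Pex Pub) => n /asboolP [U [dU UT]] max_n.
exists U => v; split=> [Tv|]; last exact: UT.
have : P (\dim (U + <[v]>)).
  apply/asboolP; exists (U + <[v]>)%VS; split=> // w /memv_addP [w1 w1U [w2 w2v ->]].
  by apply: TD; [exact: UT|case/vlineP: w2v => k ->; exact: TZ].
move=> /max_n; rewrite -dU => dim_le.
have /eqP -> : U == (U + <[v]>)%VS by rewrite eqEdim addvSl.
by apply: (subvP (addvSr _ _)); exact: memv_line.
Qed.

(* Gram-Schmidt along a generating sequence. *)
Lemma span_orthogonal_proj (B : seq E) X :
  exists2 P : E, P \in <<B>>%VS & forall v : E, v \in <<B>>%VS -> '[X - P, v] = 0.
Proof.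
elim: B X => [|a B IH] X.
  exists 0; first exact: mem0v.
  by move=> v; rewrite span_nil memv0 => /eqP ->; rewrite dotp0r.
have [Q Qs Qo] := IH X; have [b bs bo] := IH a.
(* The component of [a] orthogonal to the span of [B]; the projection is [Q] corrected along [c]. *)
set c := a - b in bo.
have sub_s (v : E) : v \in <<B>>%VS -> v \in <<a :: B>>%VS.
  by rewrite span_cons => vs; apply: (subvP (addvSr _ _)).
have a_s : a \in <<a :: B>>%VS by rewrite memv_span// mem_head.
have c_s : c \in <<a :: B>>%VS by rewrite memvB// sub_s.
have decomp (v : E) : v \in <<a :: B>>%VS -> exists k : R, v - k *: c \in <<B>>%VS.
  rewrite span_cons => /memv_addP [_ /vlineP [k ->] [w ws ->]]; exists k.
  rewrite /c (_ : _ - _ = w + k *: b) ?memvD ?memvZ//.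
  by rewrite scalerBr opprB addrC addrA subrK addrC.
exists (Q + ('[X, c] / '[c, c]) *: c).
  by rewrite memvD ?memvZ// sub_s.
move=> v /decomp [k vk]; rewrite -(subrK (k *: c) v) opprD addrA.
rewrite dotpDl dotpNl dotpZl dotpDr [X in _ - _ * X]dotpDr (Qo _ vk) (bo _ vk).
rewrite !dotpZr dotpBl (dotpC Q) (bo _ Qs).
(* If [c] vanishes, then [a] is already in the span of [B], and the correction along [c] drops
   out. *)
have [c0|c0] := eqVneq '[c, c] 0; last by field.
have -> : '[X, c] = 0.
  have /eqP : `|c| ^+ 2 = 0 by rewrite -dotpp.
  by rewrite sqrf_eq0 normr_eq0 => /eqP ->; rewrite dotp0r.
by rewrite c0; ring.
Qed.

(** By Pythagoras the orthogonal projection is the only nearest point, so it is the one that [xget]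
    selects. *)
Lemma metric_proj_subspace T X : subspace T ->
  T (metric_proj T X) /\ forall v, T v -> '[X - metric_proj T X, v] = 0.
Proof.
move=> sT; have [U TU] := subspace_vspace sT.
have [P PU PO] := span_orthogonal_proj (vbasis U) X.
rewrite (span_basis (vbasisP U)) in PU PO.
have pyth (Y : E) : Y \in U -> `|X - Y| ^+ 2 = `|X - P| ^+ 2 + `|P - Y| ^+ 2.
  move=> YU; have -> : X - Y = (X - P) + (P - Y) by rewrite subrKA.
  by rewrite sqr_normD PO ?memvB// mulr0 addr0.
have nP : nearest T X P.
  split=> [|Y /TU YU]; first exact/TU.
  by rewrite -(@ler_pXn2r _ 2%N) ?nnegrE// (pyth Y YU) lerDl sqr_ge0.
have [/TU QU Qmin] : nearest T X (metric_proj T X) by exact: xgetI nP.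
suff -> : metric_proj T X = P by split=> [|v /TU]; [exact/TU|exact: PO].
have := Qmin P nP.1.
rewrite -(@ler_pXn2r _ 2%N) ?nnegrE// (pyth _ QU) gerDl => le0.
have : `|P - metric_proj T X| ^+ 2 == 0 by rewrite eq_le le0 sqr_ge0.
by rewrite sqrf_eq0 normr_eq0 subr_eq0 => /eqP.
Qed.

(** * Tangent spaces and the directions [Gh] and [Gf] *)

Lemma tangent_space_subspace (M : set E) X : subspace (tangent_space M X).
Proof.
split=> [k U phi _|u v Tu Tv k U phi L|a u Tu k U phi L]; first by rewrite linear0.
- by rewrite linearD /= (Tu _ _ _ L) (Tv _ _ _ L) addr0.
- by rewrite linearZ /= (Tu _ _ _ L) scaler0.
Qed.

Lemma Sspace_subspace q (h : E -> euclid R q) (M : set E) X :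
  subspace (Sspace h M X).
Proof.
have [T0 TD TZ] := tangent_space_subspace M X.
split=> [|u v [hu Tu] [hv Tv]|a u [hu Tu]]; split=> /=.
- by rewrite linear0.
- exact: T0.
- by rewrite linearD /= hu hv addr0.
- exact: TD.
- by rewrite linearZ /= hu scaler0.
- exact: TZ.
Qed.

Lemma dist_ge0 X T : 0 <= dist X T.
Proof.
rewrite /dist; set D := [set _ | _ in _].
have [->|/set0P D0] := eqVneq D set0; first by rewrite inf0.
by apply: lb_le_inf => // _ [Y _ <-].
Qed.

Lemma tangent_Gh q (h : E -> euclid R q) (M : set E) X :
  tangent_space M X (Gh h M X).
Proof. exact: (metric_proj_subspace _ (tangent_space_subspace M X)).1. Qed.

Lemma tangent_Gf q (f : E -> R) (h : E -> euclid R q) (M : set E) X :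
  tangent_space M X (Gf f h M X).
Proof. by case: (metric_proj_subspace (- gradient f X) (Sspace_subspace h M X)) => -[]. Qed.

(** [Gf] lies in both subspaces, so it is orthogonal to both residuals: that of the gradient on the
    tangent space and that of its negative on [Sspace]. *)
Lemma dotp_rgrad_Gf q (f : E -> R) (h : E -> euclid R q) (M : set E) X :
  '[rgrad f M X, Gf f h M X] = - `|Gf f h M X| ^+ 2.
Proof.
have [SG SO] := metric_proj_subspace (- gradient f X) (Sspace_subspace h M X).
have [_ TO] := metric_proj_subspace (gradient f X) (tangent_space_subspace M X).
have TG : tangent_space M X (Gf f h M X) by exact: tangent_Gf.
have := SO _ SG; have := TO _ TG.
rewrite -/(rgrad _ _ _) -/(Gf _ _ _ _) !dotpBl dotpNl dotpp.
by move=> /eqP; rewrite subr_eq0 => /eqP ->; lra.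
Qed.

(** Cauchy-Schwarz in the previous identity; this carries the bound [Mf] over from [rgrad] to
    [Gf]. *)
Lemma norm_Gf_le q (f : E -> R) (h : E -> euclid R q) (M : set E) X :
  `|Gf f h M X| <= `|rgrad f M X|.
Proof.
have := cauchy_schwarz (- rgrad f M X) (Gf f h M X).
rewrite dotpNl dotp_rgrad_Gf opprK normrN expr2.
have [->|G0] := eqVneq (Gf f h M X) 0; first by rewrite normr0.
by rewrite ler_pM2r// normr_gt0.
Qed.

End InnerProduct.

(** * Rates and limits from a descent inequality *)

Section RealSequences.
Variable R : realType.
Implicit Types (u L : nat -> R).

Lemma nneg_bounded_sums_cvg0 u B : (forall k, 0 <= u k) ->
  (forall K, \sum_(k < K) u k <= B) -> u k @[k --> \oo] --> (0 : R).
Proof.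
move=> u0 uB; apply: (@cvg_series_cvg_0 R R^o).
apply: nondecreasing_is_cvgn.
  by apply: nondecreasing_series => n _ _; exact: u0.
by exists B => _ [n _ <-]; rewrite seriesEord; exact: uB.
Qed.

(** For [0 < K] the default [u 0] is itself one of the terms, so this is the true minimum. *)
Lemma bigmin_le_sum u K : (0 < K)%N ->
  \big[Num.min/u 0%N]_(k < K) u k * K%:R <= \sum_(k < K) u k.
Proof.
move=> K0; rewrite mulr_natr -[X in _ *+ X]card_ord -sumr_const.
by apply: ler_sum => i _; exact: bigmin_le.
Qed.

Lemma telescope_descent L u m : (forall k, L k.+1 <= L k - u k) ->
  (forall k, m <= L k) -> forall K, \sum_(k < K) u k <= L 0%N - m.
Proof.
move=> Lu Lm K; suff : \sum_(k < K) u k <= L 0%N - L K by have := Lm K; lra.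
elim: K => [|K IH]; first by rewrite big_ord0 subrr.
by rewrite big_ord_recr /=; have := Lu K; lra.
Qed.

(** Serves twice, with [u] the infeasibility and with [u] the squared norm of [Gf]. *)
Lemma descent_rates L u c m : 0 < c -> (forall k, 0 <= u k) ->
  (forall k, L k.+1 <= L k - c * u k) -> (forall k, m <= L k) ->
  (forall K, (0 < K)%N ->
     \big[Num.min/u 0%N]_(k < K) u k <= (L 0%N - m) / (c * K%:R)) /\
  (u k @[k --> \oo] --> (0 : R)).
Proof.
move=> c0 u0 Lu Lm; have sum_le K : c * \sum_(k < K) u k <= L 0%N - m.
  by rewrite mulr_sumr; exact: (telescope_descent Lu Lm).
split=> [K K0|].
  rewrite ler_pdivlMr ?mulr_gt0 ?ltr0n//.
  apply: le_trans (sum_le K).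
  by rewrite mulrCA ler_pM2l// bigmin_le_sum.
apply: (@nneg_bounded_sums_cvg0 _ ((L 0%N - m) / c)) => // K.
by rewrite ler_pdivlMr// mulrC.
Qed.

End RealSequences.

(* One step X -> X_+, with [d], [d'], [g] standing for delta(X), delta(X_+),
   |G_f(X)|, and [f], [f'], [n2] for f(X), f(X_+), |eta|^2. *)
Section PenaltyDescent.
Variables (R : realType) (a1 a2 a3 a4 Mf Cn Lf lambda Delta Delta0 tau : R).
Variables (alpha beta d d' g : R).
Hypotheses (a2_gt0 : 0 < a2) (a3_gt0 : 0 < a3) (a4_gt0 : 0 < a4).
Hypotheses (Cn_gt0 : 0 < Cn) (Lf_gt0 : 0 < Lf) (lambda_gt0 : 0 < lambda).
Hypotheses (alpha_gt0 : 0 < alpha) (beta_gt0 : 0 < beta).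
Hypotheses (d_ge0 : 0 <= d) (g_ge0 : 0 <= g) (g_le : g <= Mf).
Hypotheses (beta_le : beta <= tau * alpha) (tau_le : a3 * Mf * tau <= a1 / 8).
Hypothesis d'_le : d' <= (1 - a1 * alpha + a2 * alpha ^+ 2) * d
                         + a3 * beta * d * g + a4 * beta ^+ 2 * g ^+ 2.

Let Mf_ge0 : 0 <= Mf.
Proof. exact: le_trans g_le. Qed.

(** Bound [g] by [Mf], then [beta] by [tau * alpha]. *)
Let cross_term : a3 * beta * d * g <= a1 / 8 * (alpha * d).
Proof.
have ad0 : 0 <= alpha * d by rewrite mulr_ge0// ltW.
apply: le_trans (ler_wpM2r ad0 tau_le).
apply: (@le_trans _ _ (a3 * beta * d * Mf)).
  by rewrite ler_wpM2l// !mulr_ge0// ltW.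
rewrite [leRHS](_ : _ = a3 * d * Mf * (tau * alpha)); last by ring.
rewrite [leLHS](_ : _ = a3 * d * Mf * beta); last by ring.
by rewrite ler_wpM2l// !mulr_ge0// ltW.
Qed.

(** The quadratic and cross terms cost [a1 / 4] and [a1 / 8] of the linear decrease, less than half
    of it. Hence [d'] is at most the convex combination of [d] and [Delta0] with weight
    [a1 * alpha / 2] on [Delta0]. *)
Lemma infeasibility_invariant :
  a2 * alpha <= a1 / 4 -> a1 * alpha <= 1 ->
  a4 * Mf ^+ 2 * tau * beta <= a1 * Delta0 / 2 -> d <= Delta0 -> d' <= Delta0.
Proof.
move=> le2 le1 le4 dD.
have quad : a2 * alpha ^+ 2 * d <= a1 / 4 * (alpha * d).
  rewrite [leLHS](_ : _ = a2 * alpha * (alpha * d)); last by ring.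
  by rewrite ler_wpM2r// mulr_ge0// ltW.
have tail : a4 * beta ^+ 2 * g ^+ 2 <= a1 * Delta0 / 2 * alpha.
  apply: le_trans (ler_wpM2r (ltW alpha_gt0) le4).
  apply: (@le_trans _ _ (a4 * beta ^+ 2 * Mf ^+ 2)).
    apply: ler_wpM2l; first by rewrite mulr_ge0 ?sqr_ge0// ltW.
    by rewrite ler_pXn2r// nnegrE// (le_trans g_ge0).
  rewrite [leRHS](_ : _ = a4 * Mf ^+ 2 * beta * (tau * alpha)); last by ring.
  rewrite [leLHS](_ : _ = a4 * Mf ^+ 2 * beta * beta); last by ring.
  by rewrite ler_wpM2l// !mulr_ge0 ?sqr_ge0// ltW.
(* The sign of [a1] is recovered from [0 <= a2 * alpha <= a1 / 4]. *)
have a1_ge0 : 0 <= a1.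
  by have : 0 <= a2 * alpha by [rewrite mulr_ge0// ltW]; lra.
have gap : 0 <= (1 - a1 * alpha / 2) * (Delta0 - d).
  by rewrite mulr_ge0// subr_ge0//; lra.
have lin : 0 <= a1 * (alpha * d) by rewrite !mulr_ge0// ltW.
have := cross_term; have := d'_le; lra.
Qed.

(** Coefficients of [alpha * d] in units of [Mf * Cn]: 1 from [f], -2 from the penalty, 1/4 from the
    cross term, 1/4 from the [alpha ^+ 2] terms; total -1/2. For [beta * g ^+ 2]: -1 from [f], at
    most 1/2 from the [beta ^+ 2] terms. *)
Lemma merit_descent (f f' : R) (n2 : R) :
  lambda * a1 = 2 * (Mf * Cn) -> d <= Delta ->
  alpha * (Lf * Cn ^+ 2 * Delta + lambda * a2) <= Mf * Cn / 4 ->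
  beta * (Lf + lambda * a4) <= 1 / 2 ->
  f' <= f + (alpha * (Mf * Cn * d) - beta * g ^+ 2) + Lf / 2 * n2 ->
  n2 <= 2 * (alpha * (Cn * d)) ^+ 2 + 2 * (beta * g) ^+ 2 ->
  f' + lambda * d' <= f + lambda * d - Mf * Cn / 2 * alpha * d
                      - 1 / 2 * beta * g ^+ 2.
Proof.
move=> lambdaE dD le_alpha le_beta f'_le n2_le.
have ad0 : 0 <= alpha * d by rewrite mulr_ge0// ltW.
have bg0 : 0 <= beta * g ^+ 2 by rewrite mulr_ge0 ?sqr_ge0// ltW.
have n2L := ler_wpM2l (ltW Lf_gt0) n2_le.
have d'L := ler_wpM2l (ltW lambda_gt0) d'_le.
have crossL := ler_wpM2l (ltW lambda_gt0) cross_term.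
have sqd : Lf * (alpha * (Cn * d)) ^+ 2 <= alpha * (Lf * Cn ^+ 2 * Delta) * (alpha * d).
  rewrite [leLHS](_ : _ = Lf * Cn ^+ 2 * alpha * (alpha * d) * d); last by ring.
  rewrite [leRHS](_ : _ = Lf * Cn ^+ 2 * alpha * (alpha * d) * Delta); last by ring.
  by rewrite ler_wpM2l// !mulr_ge0 ?sqr_ge0// ltW.
have alphaL := ler_wpM2r ad0 le_alpha.
have betaL := ler_wpM2r bg0 le_beta.
have lambda_ad : lambda * a1 * (alpha * d) = 2 * (Mf * Cn) * (alpha * d).
  by rewrite lambdaE.
have := f'_le; lra.
Qed.

End PenaltyDescent.

Theorem theorem6p8
  (R : realType) (E : euclideanType R) (q : nat)
  (M : set E) (f : E -> R) (h : E -> euclid R q) (Rt : E -> E -> E)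
  (Delta : R)
  (M_submanifold : embedded_submanifold M)
  (f_smooth : smooth_on setT f)
  (h_smooth : smooth_on setT h)
  (Rt_retraction : is_retraction M Rt)
  (Delta_gt0 : 0 < Delta)
  (h_full_rank : forall X, tube h Delta X -> \dim (limg (Dlin h X)) = q)
  (h_transversal : forall X, (tube h Delta `&` M) X ->
     intrinsically_transversal (level h X) M X)
  (proj_single_valued : forall X, tube h Delta X ->
     exists! P, nearest (feasible h) X P)
  (proj_lipschitz : [lipschitz metric_proj (feasible h) X | X in tube h Delta])
  (f_bounded_below : has_lbound (f @` (tube h Delta `&` M)))
  (sigma mu Lh : R)
  (sigma_gt0 : 0 < sigma) (mu_gt0 : 0 < mu) (Lh_gt0 : 0 < Lh)
  (gram_ge : forall X, tube h Delta X ->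
     loewner_le (sigma ^+ 2 *: \1%VF) (gram h X))
  (gram_le : forall X, tube h Delta X ->
     loewner_le (gram h X) (mu ^+ 2 *: \1%VF))
  (Dh_lipschitz : forall X Y, tube h Delta X -> tube h Delta Y ->
     opnorm (Dlin h X - Dlin h Y) <= Lh * `|X - Y|)
  (proj_C1 : Ck_on 1 (tube h Delta) (metric_proj (feasible h)))
  (Lp : R) (Lp_gt0 : 0 < Lp)
  (Dproj_lipschitz : forall X Y, tube h Delta X -> tube h Delta Y ->
     opnorm (Dlin (metric_proj (feasible h)) X - Dlin (metric_proj (feasible h)) Y)
       <= Lp * `|X - Y|)
  (LR Lf Mf rhoM : R)
  (LR_gt0 : 0 < LR) (Lf_gt0 : 0 < Lf) (Mf_gt0 : 0 < Mf) (rhoM_gt0 : 0 < rhoM)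
  (retraction_bounds : forall X eta, (tube h Delta `&` M) X ->
     tangent_space M X eta -> `|eta| <= rhoM ->
     [/\ `|X + eta - Rt X eta| <= LR * `|eta| ^+ 2,
         `|rgrad f M X| <= Mf
       & f (Rt X eta) <= f X + '[rgrad f M X, eta] + Lf / 2 * `|eta| ^+ 2])
  (kappa0 : R) (kappa0_gt0 : 0 < kappa0)
  (Gh_ge : forall X, (tube h Delta `&` M) X ->
     kappa0 * `|dnormal h X| <= `|metric_proj (tangent_space M X) (dnormal h X)|)
  (Cn : R) (Cn_gt0 : 0 < Cn)
  (Gh_le : forall X, (tube h Delta `&` M) X -> `|Gh h M X| <= Cn * delta h X)
  (a1 : R) (a1_gt0 : 0 < a1)
  (delta_step : exists a2 a3 a4 abar bbar : R,
     [/\ 0 < a2, 0 < a3, 0 < a4, 0 < abar & 0 < bbar] /\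
     forall X (alpha beta : R), (tube h Delta `&` M) X ->
       0 < alpha -> alpha <= abar -> 0 < beta -> beta <= bbar ->
       delta h (Rt X (alpha *: Gh h M X + beta *: Gf f h M X))
         <= (1 - a1 * alpha + a2 * alpha ^+ 2) * delta h X
            + a3 * beta * delta h X * `|Gf f h M X|
            + a4 * beta ^+ 2 * `|Gf f h M X| ^+ 2)
  (Delta0 : R) (Delta0_gt0 : 0 < Delta0) (Delta0_lt : Delta0 < Delta)
  (X0 : E) (X0_M : M X0) (X0_delta : delta h X0 <= Delta0) :
  let finf := inf (f @` (tube h Delta `&` M)) in
  let lambda := 2 * Mf * Cn / a1 in
  let Lag := fun X : E => f X + lambda * delta h X in
  exists abar2 bbar2 tau2 cdelta ct : R,
    [/\ 0 < abar2, 0 < bbar2, 0 < tau2, 0 < cdelta & 0 < ct] /\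
    forall alpha beta : R,
      0 < alpha -> 0 < beta ->
      alpha <= abar2 -> beta <= bbar2 -> beta <= tau2 * alpha ->
    forall X : nat -> E,
      X 0%N = X0 ->
      (forall k, X k.+1 =
         Rt (X k) (alpha *: Gh h M (X k) + beta *: Gf f h M (X k))) ->
    [/\ forall k, (tube h Delta `&` M) (X k) /\
          Lag (X k.+1) <= Lag (X k) - cdelta * alpha * delta h (X k)
                          - ct * beta * `|Gf f h M (X k)| ^+ 2,
        forall K, (1 <= K)%N ->
          \big[Num.min/delta h (X 0%N)]_(k < K) delta h (X k)
            <= (Lag X0 - finf) / (cdelta * alpha * K%:R) /\
          \big[Num.min/`|Gf f h M (X 0%N)| ^+ 2]_(k < K)
              `|Gf f h M (X k)| ^+ 2
            <= (Lag X0 - finf) / (ct * beta * K%:R),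
        delta h (X k) @[k --> \oo] --> (0 : R)
      & `|Gf f h M (X k)| @[k --> \oo] --> (0 : R)].
Proof.
move=> finf lambda Lag.
have [a2 [a3 [a4 [abar [bbar [[a2_gt0 a3_gt0 a4_gt0 abar_gt0 bbar_gt0] step]]]]]] :=
  delta_step.
have lambda_gt0 : 0 < lambda by rewrite divr_gt0// !mulr_gt0.
have lambdaE : lambda * a1 = 2 * (Mf * Cn).
  by rewrite divfK ?mulrA// gt_eqF.
clearbody lambda.
(* The largest [tau] allowed by the cross term estimate. *)
pose tau := a1 / (8 * (a3 * Mf)).
have tau_gt0 : 0 < tau by rewrite divr_gt0// !mulr_gt0.
have tauE : a3 * Mf * tau = a1 / 8.
  by rewrite /tau; field; rewrite !gt_eqF.
clearbody tau.
pose A := Lf * Cn ^+ 2 * Delta + lambda * a2.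
have A_gt0 : 0 < A by rewrite addr_gt0// !mulr_gt0.
pose B := Lf + lambda * a4.
have B_gt0 : 0 < B by rewrite addr_gt0// mulr_gt0.
pose C := a4 * Mf ^+ 2 * tau.
have C_gt0 : 0 < C by rewrite !mulr_gt0.
(* In order: validity of [delta_step], two conditions for invariance, merit descent, and half of the
   radius [rhoM] for the [Gh] part of the step. *)
pose abar2 := Num.min (Num.min abar (a1 / 4 / a2))
  (Num.min a1^-1 (Num.min (Mf * Cn / 4 / A) (rhoM / 2 / (Cn * Delta)))).
(* In order: [delta_step], merit descent, invariance, and the other half of [rhoM] for the [Gf]
   part. *)
pose bbar2 := Num.min (Num.min bbar (1 / 2 / B))
  (Num.min (a1 * Delta0 / 2 / C) (rhoM / 2 / Mf)).
have CnD_gt0 : 0 < Cn * Delta by rewrite mulr_gt0.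
exists abar2, bbar2, tau, (Mf * Cn / 2), (1 / 2).
split; first split=> //.
  - by rewrite !lt_min abar_gt0 invr_gt0 a1_gt0 !(mulr_gt0, invr_gt0).
  - by rewrite !lt_min bbar_gt0 !(mulr_gt0, invr_gt0).
  - by rewrite !mulr_gt0 ?invr_gt0.
move=> alpha beta alpha_gt0 beta_gt0.
rewrite !le_min => /andP [/andP [alpha_abar +] /and3P [+ + +]].
rewrite -[a1^-1]div1r !ler_pdivlMr// => alpha_a2 alpha_a1 alpha_A alpha_rho.
move=> /andP [/andP [beta_bbar +] /andP [+ +]].
move=> beta_B beta_C beta_rho beta_tau X X_0 X_S.
pose d k := delta h (X k); pose g k := `|Gf f h M (X k)|.
have d_ge0 k : 0 <= d k by exact: dist_ge0.
have g_ge0 k : 0 <= g k by exact: normr_ge0.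
have tube_M Y : M Y -> delta h Y <= Delta0 -> (tube h Delta `&` M) Y.
  by move=> MY dY; split; rewrite //= /tube /=; exact: le_lt_trans Delta0_lt.
have g_le k : (tube h Delta `&` M) (X k) -> g k <= Mf.
  move=> XK; apply: le_trans (norm_Gf_le _ _ _ _) _.
  (* The gradient bound in [retraction_bounds] is tied to a short tangent vector; the zero vector
     will do. *)
  have [T0 _ _] := tangent_space_subspace M (X k).
  by case: (retraction_bounds _ _ XK T0); rewrite // normr0 ltW.
pose eta k := alpha *: Gh h M (X k) + beta *: Gf f h M (X k).
have T_eta k : tangent_space M (X k) (eta k).
  have [_ TD TZ] := tangent_space_subspace M (X k).
  by apply: TD; apply: TZ; [exact: tangent_Gh|exact: tangent_Gf].
have d_S k : (tube h Delta `&` M) (X k) ->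
    d k.+1 <= (1 - a1 * alpha + a2 * alpha ^+ 2) * d k
              + a3 * beta * d k * g k + a4 * beta ^+ 2 * g k ^+ 2.
  by move=> XK; rewrite /d X_S; exact: step.
have [Rt_M _ _] := Rt_retraction.
(* Both claims go through one induction, since the estimate on [d k.+1] requires [X k] to lie in the
   tube and on [M]. *)
have inv k : M (X k) /\ d k <= Delta0.
  elim: k => [|k [MX dX]]; first by rewrite /d X_0.
  have XK := tube_M _ MX dX.
  split; first by rewrite X_S; exact: (Rt_M (X k, eta k) (conj MX (T_eta k))).
  apply: (infeasibility_invariant a2_gt0 a3_gt0 a4_gt0 alpha_gt0 beta_gt0 _ _
    (g_le k XK) beta_tau _ (d_S k XK)) => //; rewrite ?tauE//.
  - by lra.
  - by lra.
  - by rewrite -/C; lra.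
have XK k : (tube h Delta `&` M) (X k).
  by have [MX dX] := inv k; exact: tube_M.
have d_le k : d k <= Delta by have [/ltW] := XK k.
have descent k : Lag (X k.+1) <= Lag (X k) - Mf * Cn / 2 * alpha * d k
                                 - 1 / 2 * beta * g k ^+ 2.
  have Gh_d : `|alpha *: Gh h M (X k)| <= alpha * (Cn * d k).
    by rewrite normrZ gtr0_norm// ler_pM2l// Gh_le.
  have Gf_g : `|beta *: Gf f h M (X k)| = beta * g k.
    by rewrite normrZ gtr0_norm.
  have eta_le : `|eta k| <= rhoM.
    apply: le_trans (ler_normD _ _) _; rewrite Gf_g.
    have := ler_wpM2l (ltW alpha_gt0) (ler_wpM2l (ltW Cn_gt0) (d_le k)).
    have := ler_wpM2l (ltW beta_gt0) (g_le k (XK k)); lra.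
  have [_ grad_le f_le] := retraction_bounds _ _ (XK k) (T_eta k) eta_le.
  apply: (merit_descent a3_gt0 Cn_gt0 Lf_gt0 lambda_gt0 alpha_gt0 beta_gt0 _ _
    (g_le k (XK k)) beta_tau _ (d_S k (XK k)) lambdaE (d_le k) _ _
    (n2 := `|eta k| ^+ 2)) => //; rewrite ?tauE//.
  - by rewrite -/A; lra.
  - by rewrite -/B; lra.
  - rewrite X_S; apply: le_trans f_le _; rewrite lerD2r lerD2l.
    (* The [Gf] part gives exactly [- beta * g k ^+ 2]; only the [Gh] part needs Cauchy-Schwarz. *)
    rewrite /eta dotpDr !dotpZr dotp_rgrad_Gf mulrN lerD2r ler_pM2l//.
    apply: le_trans (cauchy_schwarz _ _) _; rewrite -mulrA.
    by apply: ler_pM => //; exact: Gh_le.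
  - apply: le_trans (sqr_normD_le _ _) _; rewrite Gf_g lerD2r ler_pM2l//.
    by rewrite ler_pXn2r// nnegrE// (le_trans _ Gh_d).
have finf_le k : finf <= Lag (X k).
  apply: (@le_trans _ _ (f (X k))).
    by apply: ge_inf => //; exists (X k); first exact: XK.
  by rewrite lerDl; apply: mulr_ge0; [exact: ltW|exact: d_ge0].
have cd_gt0 : 0 < Mf * Cn / 2 * alpha by rewrite !mulr_gt0.
have ct_gt0 : 0 < 1 / 2 * beta by rewrite mulr_gt0.
(* Each rate keeps one of the two decrease terms and discards the other, which is nonnegative. *)
have d_descent k : Lag (X k.+1) <= Lag (X k) - Mf * Cn / 2 * alpha * d k.
  by have := descent k; have := mulr_ge0 (ltW ct_gt0) (sqr_ge0 (g k)); lra.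
have g_descent k : Lag (X k.+1) <= Lag (X k) - 1 / 2 * beta * g k ^+ 2.
  by have := descent k; have := mulr_ge0 (ltW cd_gt0) (d_ge0 k); lra.
have [d_rate d_cvg] := descent_rates (L := Lag \o X) cd_gt0 d_ge0 d_descent finf_le.
have [g_rate g2_cvg] := descent_rates (L := Lag \o X) ct_gt0
  (fun k => sqr_ge0 (g k)) g_descent finf_le.
split=> //.
- by move=> K K_gt0; rewrite -X_0; split; [exact: d_rate|exact: g_rate].
(* The squares tend to 0, hence so do the norms, by continuity of the square root. *)
- rewrite -sqrtr0 (_ : (fun k => _) = (fun k => Num.sqrt (g k ^+ 2))).
    by apply: continuous_cvg => //; exact: sqrt_continuous.
  by apply/funext => k; rewrite sqrtr_sqr ger0_norm.
Qed.
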